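(* The semigroup inclusion class $[\,xy \in \{x,y\}\,]$, i.e. the class of all semigroups $S$ such that $xy\in\{x,y\}$ for all $x,y\in S$, is not a union of semigroup varieties.
   Context: A semigroup variety is the class of all semigroups satisfying some (possibly infinite) set of semigroup identities. Semigroups are nonempty. Union means union of an arbitrary collection of classes of semigroups. *)

(* Defs.v *)
From HB Require Import structures.
From mathcomp Require Import all_boot.

Set Implicit Arguments.
Unset Strict Implicit.
Unset Printing Implicit Defensive.

Local Open Scope group_scope.

(* MathComp's semigroupType bundles a choice operator on the carrier and does
   not exclude the empty carrier; to range over all nonempty semigroups, only
   its operation layer magmaType (a bare type with a product) is reused. *)
Record semigroup := MkSemigroup {
  semigroup_sort :> magmaType;
  semigroup_mulA : forall x y z : semigroup_sort, x * (y * z) = (x * y) * z;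
  semigroup_nonempty : inhabited semigroup_sort
}.

Definition semigroup_class := semigroup -> Prop.

(* A nonempty word over the variables x_0, x_1, ...: its first letter and the
   sequence of the remaining ones. *)
Definition word : Type := nat * seq nat.

Definition word_eval (S : semigroup) (v : nat -> S) (w : word) : S :=
  foldl (fun p i => p * v i) (v w.1) w.2.

(* The pair (u, w) stands for the identity u = w. *)
Definition identity : Type := word * word.

Definition satisfies (S : semigroup) (e : identity) : Prop :=
  forall v : nat -> S, word_eval v e.1 = word_eval v e.2.

Definition is_variety (V : semigroup_class) : Prop :=
  exists E : identity -> Prop,
    forall S : semigroup, V S <-> (forall e : identity, E e -> satisfies S e).

Definition is_union_of_varieties (C : semigroup_class) : Prop :=
  exists F : semigroup_class -> Prop,
    (forall V : semigroup_class, F V -> is_variety V) /\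
    (forall S : semigroup, C S <-> (exists V : semigroup_class, F V /\ V S)).

(* The inclusion class [xy \in {x, y}]. *)
Definition quasitrivial_class : semigroup_class :=
  fun S => forall x y : S, x * y = x \/ x * y = y.

(* Main.v *)
From HB Require Import structures.
From mathcomp Require Import all_boot.
Require Import Defs.

Set Implicit Arguments.
Unset Strict Implicit.
Unset Printing Implicit Defensive.

Local Open Scope group_scope.

(** Varieties are closed under direct products, hence a union of varieties
    contains the square of each of its members. The two-element semilattice B
    satisfies [xy \in {x, y}], but B x B does not:
    (1, 0) (0, 1) = (0, 0). *)

Lemma prod_mulA (S T : semigroup) (x y z : (S * T)%type) :
  x * (y * z) = (x * y) * z.
Proof. by congr pair; apply: semigroup_mulA. Qed.

Lemma prod_inhabited (S T : semigroup) : inhabited (S * T).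
Proof. by case: (semigroup_nonempty S) (semigroup_nonempty T) => x [y]. Qed.

Definition prod_semigroup (S T : semigroup) : semigroup :=
  MkSemigroup (@prod_mulA S T) (prod_inhabited S T).

(** Both projections are homomorphisms, so they commute with evaluation. *)
Lemma word_eval_prod (S T : semigroup) (v : nat -> prod_semigroup S T)
    (w : word) :
  word_eval v w =
  (word_eval (fun i => (v i).1) w, word_eval (fun i => (v i).2) w).
Proof.
(* Splitting the initial accumulator of [foldl] into a pair lets the induction generalize over both
   components. *)
rewrite /word_eval [in LHS](surjective_pairing (v w.1)).
by elim: w.2 (v w.1).1 (v w.1).2 => //= i s IHs x y; rewrite -IHs.
Qed.

Lemma variety_prod (V : semigroup_class) (S T : semigroup) :
  is_variety V -> V S -> V T -> V (prod_semigroup S T).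
Proof.
move=> [E VE] /VE SE /VE TE; apply/VE => e Ee v.
by rewrite !word_eval_prod (SE e Ee) (TE e Ee).
Qed.

(** This is the semilattice B, with [true] as 1 and [false] as 0. *)
HB.instance Definition _ := hasMul.Build bool andb.

Definition bool_semigroup : semigroup := MkSemigroup andbA (inhabits true).

Lemma bool_semigroup_quasitrivial : quasitrivial_class bool_semigroup.
(* [true] is neutral and [false] is absorbing, so the left factor decides the case. *)
Proof. by move=> [] y; [right | left]. Qed.

Theorem proposition32 : ~ is_union_of_varieties quasitrivial_class.
Proof.
move=> [F [Fvar FC]].
have [V [FV VB]] := (FC _).1 bool_semigroup_quasitrivial.
have /FC QBB : exists W, F W /\ W (prod_semigroup bool_semigroup bool_semigroup).
  by exists V; split=> //; apply: variety_prod => //; apply: Fvar.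
by case: (QBB (true, false) (false, true)).
Qed.
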